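(* Let $M$ be a free monoid on at least two generators. Then $\mathrm{PSh}(M)$ is a $1$-dimensional topos without boundary (over $\mathsf{Set}$).
   Context: $\mathrm{PSh}(M)$ is the topos of presheaves on $M$ viewed as a one-object category, i.e. the category of right $M$-sets. Dimension of a Grothendieck topos over $\mathsf{Set}$: for a set $A$ (a group if $m\ge1$, abelian if $m\geq 2$), $\mathrm{H}^m(\mathcal{E},A)$ is the cohomology of $\mathcal{E}$ with coefficients in the constant object $A$: global sections for $m=0$, isomorphism classes of $A$-torsors for $m=1$, usual sheaf cohomology for $m\ge2$ (and for $m=1$ with $A$ abelian). Equivalently it is $\pi_0$ of the simplicial set of global sections of an injectively fibrant Eilenberg--Mac Lane object $K(A,m)$ in simplicial objects of $\mathcal{E}$. For $n\ge0$ a geometric morphism $\rho:\mathcal{F}\to\mathcal{E}$ is $n$-pure if for all objects $X$ of $\mathcal{E}$, all $0\leq m\leq n$, and all sets $A$ (groups if $m\ge1$, abelian if $m\ge2$), the pullback map $\mathrm{H}^m(\mathcal{E}/X,A)\to\mathrm{H}^m(\mathcal{F}/\rho^*X,A)$ is bijective; it is $(-1)$-pure if for $m=0$ these maps are injective for all $X$, $A$; every geometric morphism is $(-2)$-pure. A monomorphism $V\hookrightarrow U$ in $\mathcal{E}$ is $n$-pure if $\mathcal{E}/V\to\mathcal{E}/U$ is. The $(n-1)$-pure monomorphisms are the dense monomorphisms of a Lawvere--Tierney topology on $\mathcal{E}$, with subtopos $\mathcal{E}_{\leq n}$ ($n\ge-1$). Put $\mathcal{E}_{<\infty}=\bigcup_n\mathcal{E}_{\leq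 n}$ (union of subtoposes). $\mathcal{E}$ is $n$-dimensional if $n$ is the smallest integer $\ge-1$ with $\mathcal{E}_{\leq n}=\mathcal{E}_{<\infty}$, and is without boundary if $\mathcal{E}_{<\infty}=\mathcal{E}$. *)

(* Defs.v *)
From HB Require Import structures.
From mathcomp Require Import all_boot all_order all_algebra.
From mathcomp Require Import boolp classical_sets.
Set Implicit Arguments.
Unset Strict Implicit.
Unset Printing Implicit Defensive.

Import GRing.Theory Num.Theory.
Local Open Scope classical_set_scope.
Local Open Scope ring_scope.

Definition free_on (S : Type) (M : monoidType) (i : S -> M) : Prop :=
  forall (N : monoidType) (f : S -> N),
    (exists g : UMagmaMorphism.type M N, forall s, g (i s) = f s) /\
    (forall g h : UMagmaMorphism.type M N,
        (forall s, g (i s) = f s) -> (forall s, h (i s) = f s) ->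
        forall x, g x = h x).

Record rset (M : monoidType) := RSet {
  rcar :> Type;
  ract : rcar -> M -> rcar;
  ract1 : forall x, ract x 1%g = x;
  ractM : forall x m n, ract x (m * n)%g = ract (ract x m) n }.

Record rhom (M : monoidType) (X Y : rset M) := RHom {
  rfun :> X -> Y;
  rfunJ : forall x m, rfun (ract x m) = ract (rfun x) m }.

Lemma rhom_comp_subproof (M : monoidType) (X Y Z : rset M)
    (g : rhom Y Z) (f : rhom X Y) x m :
  g (f (ract x m)) = ract (g (f x)) m.
Proof. by rewrite !rfunJ. Qed.

Definition rhom_comp (M : monoidType) (X Y Z : rset M)
    (g : rhom Y Z) (f : rhom X Y) : rhom X Z :=
  RHom (rhom_comp_subproof g f).

Section Constant.
Variables (M : monoidType) (A : Type).

Definition constant : rset M :=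
  @RSet M A (fun a _ => a) (fun _ => erefl) (fun _ _ _ => erefl).

End Constant.

Section Pullback.
Variables (M : monoidType) (X V U : rset M) (f : rhom X U) (i : rhom V U).

Definition pb_car : Type := {xv : X * V | f xv.1 = i xv.2}.

Lemma pb_act_subproof (p : pb_car) (m : M) :
  f (ract (sval p).1 m) = i (ract (sval p).2 m).
Proof. by rewrite !rfunJ (proj2_sig p). Qed.

Definition pb_act (p : pb_car) (m : M) : pb_car :=
  exist (fun xv : X * V => f xv.1 = i xv.2)
    (ract (sval p).1 m, ract (sval p).2 m) (pb_act_subproof p m).

Lemma pb_act1 p : pb_act p 1%g = p.
Proof. by case: p => -[x v] e; apply: eq_exist => /=; rewrite !ract1. Qed.

Lemma pb_actM p m n : pb_act p (m * n)%g = pb_act (pb_act p m) n.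
Proof. by case: p => -[x v] e; apply: eq_exist => /=; rewrite !ractM. Qed.

Definition pullback : rset M := RSet pb_act1 pb_actM.

Definition pb_fst : rhom pullback X :=
  @RHom M pullback X (fun p => (sval p).1) (fun _ _ => erefl).

End Pullback.

Definition right_ideal (M : monoidType) (I : set M) : Prop :=
  forall m n, I m -> I (m * n)%g.

Section Omega.
Variable M : monoidType.

Definition omega_car : Type := {I : set M | right_ideal I}.

Lemma omega_act_subproof (I : omega_car) (m : M) :
  right_ideal [set n | sval I (m * n)%g].
Proof. by move=> n p /= Imn; rewrite mulgA; exact: (proj2_sig I). Qed.

Definition omega_act (I : omega_car) (m : M) : omega_car :=
  exist _ _ (@omega_act_subproof I m).

Lemma omega_eq (I J : omega_car) : sval I = sval J -> I = J.
Proof. by case: I J => [I hI] [J hJ] /= e; apply: eq_exist. Qed.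

Lemma omega_act1 I : omega_act I 1%g = I.
Proof.
by apply: omega_eq; apply/predeqP => m /=; rewrite mul1g.
Qed.

Lemma omega_actM I m n : omega_act I (m * n)%g = omega_act (omega_act I m) n.
Proof.
by apply: omega_eq; apply/predeqP => p /=; rewrite mulgA.
Qed.

Definition Omega : rset M := RSet omega_act1 omega_actM.

Lemma top_subproof : right_ideal [set: M].
Proof. by []. Qed.

Definition top_ideal : Omega := exist _ _ top_subproof.

Lemma meet_subproof (I J : Omega) : right_ideal (sval I `&` sval J).
Proof. by move=> m n [Im Jm]; split; [exact: (proj2_sig I)|exact: (proj2_sig J)]. Qed.

Definition meet_ideal (I J : Omega) : Omega := exist _ _ (@meet_subproof I J).

Record lt_topology := LTTopology {
  lt_j :> rhom Omega Omega;
  lt_top : lt_j top_ideal = top_ideal;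
  lt_idem : forall I, lt_j (lt_j I) = lt_j I;
  lt_meet : forall I J, lt_j (meet_ideal I J) = meet_ideal (lt_j I) (lt_j J) }.

Section Characteristic.
Variables (V U : rset M) (i : rhom V U).

Lemma chi_subproof (u : U) : right_ideal [set m | exists v, i v = ract u m].
Proof. by move=> m n /= [v e]; exists (ract v n); rewrite rfunJ e ractM. Qed.

(* the value at [u] of the classifying map of the image of [i] *)
Definition chi (u : U) : Omega := exist _ _ (@chi_subproof u).

Definition dense (j : lt_topology) : Prop := forall u, j (chi u) = top_ideal.

End Characteristic.

Definition mono_class : Type := forall V U : rset M, rhom V U -> Prop.

Definition is_sheaf (D : mono_class) (F : rset M) : Prop :=
  forall (V U : rset M) (i : rhom V U), injective i -> D V U i ->
  forall f : rhom V F,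
    (exists g : rhom U F, forall v, g (i v) = f v) /\
    (forall g h : rhom U F, (forall v, g (i v) = f v) ->
       (forall v, h (i v) = f v) -> forall u, g u = h u).

(* A subtopos is represented by its objects, as a full replete subcategory. *)
Definition subtopos_of (j : lt_topology) : rset M -> Prop :=
  is_sheaf (fun V U i => dense i j).

Definition is_subtopos (P : rset M -> Prop) : Prop :=
  exists j : lt_topology, forall F, P F <-> subtopos_of j F.

End Omega.

(* Quotients are left implicit: a map [F] that respects the equivalence
   relations [eS] and [eT] is injective, resp. bijective, on classes. *)
Definition inj_mod (S T : Type) (eS : S -> S -> Prop) (eT : T -> T -> Prop)
    (F : S -> T) : Prop :=
  forall s s', eT (F s) (F s') -> eS s s'.

Definition bij_mod (S T : Type) (eS : S -> S -> Prop) (eT : T -> T -> Prop)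
    (F : S -> T) : Prop :=
  inj_mod eS eT F /\ (forall t, exists s, eT (F s) t).

(* A section of the projection X * A -> X is a map X -> A. *)
Definition H0 (M : monoidType) (A : Type) (X : rset M) : Type :=
  rhom X (constant M A).

Definition H0_eq (M : monoidType) (A : Type) (X : rset M) (s s' : H0 A X) :
  Prop := forall x, s x = s' x.

Definition H0_pull (M : monoidType) (A : Type) (Y X : rset M) (p : rhom Y X)
    (s : H0 A X) : H0 A Y := rhom_comp s p.

(* An object T -> X of PSh(M)/X with an action of the constant group A such
   that T -> X is epi (tsurj) and A x T -> T x_X T is invertible
   (tprincipal). *)
Record torsor (M : monoidType) (A : groupType) (X : rset M) := Torsor {
  tors :> rset M;
  tproj : rhom tors X;
  tact : A -> tors -> tors;
  tact1 : forall t, tact 1%g t = t;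
  tactM : forall a b t, tact (a * b)%g t = tact a (tact b t);
  tactJ : forall a t m, tact a (ract t m) = ract (tact a t) m;
  tprojA : forall a t, tproj (tact a t) = tproj t;
  tsurj : forall x, exists t, tproj t = x;
  tprincipal : forall t t', tproj t = tproj t' -> exists! a, tact a t = t' }.

Definition torsor_iso (M : monoidType) (A : groupType) (X : rset M)
    (T T' : torsor A X) : Prop :=
  exists phi : rhom T T', [/\ bijective phi,
    forall a t, phi (tact a t) = tact a (phi t) &
    forall t, tproj T' (phi t) = tproj T t].

Section TorsorPullback.
Variables (M : monoidType) (A : groupType) (Y X : rset M) (p : rhom Y X).
Variable T : torsor A X.

Let PT : rset M := pullback p (tproj T).

Lemma tpull_act_subproof a (z : PT) :
  p (sval z).1 = tproj T (tact a (sval z).2).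
Proof. by rewrite tprojA (proj2_sig z). Qed.

Definition tpull_act (a : A) (z : PT) : PT :=
  exist (fun yt : Y * T => p yt.1 = tproj T yt.2)
    ((sval z).1, tact a (sval z).2) (tpull_act_subproof a z).

Lemma tpull_act1 z : tpull_act 1%g z = z.
Proof. by case: z => -[y t] e; apply: eq_exist => /=; rewrite tact1. Qed.

Lemma tpull_actM a b z : tpull_act (a * b)%g z = tpull_act a (tpull_act b z).
Proof. by case: z => -[y t] e; apply: eq_exist => /=; rewrite tactM. Qed.

Lemma tpull_actJ a z m : tpull_act a (ract z m) = ract (tpull_act a z) m.
Proof. by case: z => -[y t] e; apply: eq_exist => /=; rewrite tactJ. Qed.

Lemma tpull_surj y : exists z : PT, pb_fst p (tproj T) z = y.
Proof.
have [t e] := tsurj T (p y).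
by exists (exist (fun yt : Y * T => p yt.1 = tproj T yt.2) (y, t) (esym e)).
Qed.

Lemma tpull_principal (z z' : PT) :
  pb_fst p (tproj T) z = pb_fst p (tproj T) z' ->
  exists! a, tpull_act a z = z'.
Proof.
case: z z' => -[y t] e [[y' t'] e'] /= yy'; rewrite -{}yy' /= in e' *.
have [a [at' ua]] := tprincipal (etrans (esym e) e').
exists a; split=> [|b /(congr1 sval) [bt']]; last exact: ua.
by apply: eq_exist => /=; rewrite at'.
Qed.

Definition torsor_pull : torsor A Y :=
  @Torsor M A Y PT (pb_fst p (tproj T)) tpull_act tpull_act1 tpull_actM
    tpull_actJ (fun _ _ => erefl) tpull_surj tpull_principal.

End TorsorPullback.

(* An abelian group object of PSh(M)/X, given by its fibres: it is a presheaf
   of abelian groups on the category of elements of X, whose morphisms from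
   [y] to [x] are the [m] with [ract x m = y].  Its total space is the right
   M-set of pairs (x, a) with (x, a) . m = (x . m, res m a). *)
Record abgr (M : monoidType) (X : rset M) := AbGr {
  fib :> X -> zmodType;
  res : forall (m : M) (x y : X), ract x m = y -> {additive fib x -> fib y};
  res1 : forall x (e : ract x 1%g = x) a, res e a = a;
  resM : forall m n x y z (e : ract x m = y) (e' : ract y n = z)
    (e'' : ract x (m * n)%g = z) a, res e'' a = res e' (res e a) }.

Record abhom (M : monoidType) (X : rset M) (F G : abgr X) := AbHom {
  abfun :> forall x, {additive F x -> G x};
  abfun_nat : forall m x y (e : ract x m = y) a,
    abfun y (res F e a) = res G e (abfun x a) }.

(* monomorphisms and exactness in the abelian category of [abgr X] are fibrewise *)
Definition ab_injective (M : monoidType) (X : rset M) (J : abgr X) : Prop :=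
  forall (F G : abgr X) (u : abhom F G) (f : abhom F J),
    (forall x, injective (u x)) ->
    exists g : abhom G J, forall x a, g x (u x a) = f x a.

Section ConstantAb.
Variables (M : monoidType) (X : rset M) (A : zmodType).

Definition constant_ab : abgr X :=
  @AbGr M X (fun _ => A) (fun _ _ _ _ => idfun)
    (fun _ _ _ => erefl) (fun _ _ _ _ _ _ _ _ _ => erefl).

End ConstantAb.

Section PullbackAb.
Variables (M : monoidType) (Y X : rset M) (p : rhom Y X) (F : abgr X).

Lemma pull_edge m (y y' : Y) : ract y m = y' -> ract (p y) m = p y'.
Proof. by move=> <-; rewrite rfunJ. Qed.

Definition pull_ab : abgr Y :=
  @AbGr M Y (fun y => F (p y)) (fun m y y' e => res F (pull_edge e))
    (fun y e a => res1 (pull_edge e) a)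
    (fun m n x y z e e' e'' a =>
       resM (pull_edge e) (pull_edge e') (pull_edge e'') a).

End PullbackAb.

Record injres (M : monoidType) (X : rset M) (A : zmodType) := InjRes {
  ir_obj :> nat -> abgr X;
  ir_d : forall n, abhom (ir_obj n) (ir_obj n.+1);
  ir_aug : abhom (constant_ab X A) (ir_obj 0%N);
  ir_inj : forall n, ab_injective (ir_obj n);
  ir_aug_inj : forall x, injective (ir_aug x);
  ir_exact0 : forall x a, ir_d 0 x a = 0 <-> exists c, ir_aug x c = a;
  ir_exact : forall n x a, ir_d n.+1 x a = 0 <-> exists b, ir_d n x b = a }.

(* a morphism of resolutions over the identity of A, from the inverse image
   of [I] along [p] to [J] *)
Record comparison (M : monoidType) (A : zmodType) (Y X : rset M)
    (p : rhom Y X) (I : injres X A) (J : injres Y A) := Comparison {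
  cmp :> forall n, abhom (pull_ab p (I n)) (J n);
  cmp_d : forall n y a,
    cmp n.+1 y (ir_d I n (p y) a) = ir_d J n y (cmp n y a);
  cmp_aug : forall y c, cmp 0%N y (ir_aug I (p y) c) = ir_aug J y c }.

Record gsec (M : monoidType) (X : rset M) (F : abgr X) := GSec {
  gfun :> forall x, F x;
  gfun_nat : forall m x y (e : ract x m = y), res F e (gfun x) = gfun y }.

Record cocycle (M : monoidType) (X : rset M) (A : zmodType) (I : injres X A)
    (n : nat) := Cocycle {
  coc :> gsec (I n);
  coc_d : forall x, ir_d I n x (coc x) = 0 }.

Definition cohomologous (M : monoidType) (X : rset M) (A : zmodType)
    (I : injres X A) (n : nat) (s s' : cocycle I n.+1) : Prop :=
  exists t : gsec (I n), forall x, s x - s' x = ir_d I n x (t x).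

Section CocyclePullback.
Variables (M : monoidType) (A : zmodType) (Y X : rset M) (p : rhom Y X).
Variables (I : injres X A) (J : injres Y A) (phi : comparison p I J) (n : nat).
Variable s : cocycle I n.

Lemma coc_pull_nat m y y' (e : ract y m = y') :
  res (J n) e (phi n y (s (p y))) = phi n y' (s (p y')).
Proof.
by rewrite -(gfun_nat s (pull_edge p e)); rewrite -(abfun_nat (phi n) e).
Qed.

Lemma coc_pull_d y : ir_d J n y (phi n y (s (p y))) = 0.
Proof. by rewrite -cmp_d coc_d raddf0. Qed.

Definition coc_pull : cocycle J n := @Cocycle M Y A J n (GSec coc_pull_nat)
  coc_pull_d.

End CocyclePullback.

(* Bijectivity of the pullback map H^m(PSh(M)/X, A) -> H^m(PSh(M)/Y, A) for
   all admissible coefficients A.  For m >= 2 the map does not depend, up to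
   the canonical isomorphisms, on the injective resolutions nor on the
   comparison morphism. *)
Definition H_bij (M : monoidType) (m : nat) (Y X : rset M) (p : rhom Y X) :
    Prop :=
  match m with
  | 0%N => forall A : Type, bij_mod (@H0_eq M A X) (@H0_eq M A Y) (H0_pull p)
  | 1%N => forall A : groupType,
      bij_mod (@torsor_iso M A X) (@torsor_iso M A Y) (torsor_pull p)
  | k.+2 => forall (A : zmodType) (I : injres X A) (J : injres Y A)
      (phi : comparison p I J),
      bij_mod (@cohomologous M X A I k.+1) (@cohomologous M Y A J k.+1)
        (@coc_pull M A Y X p I J phi k.+2)
  end.

(* n-purity of PSh(M)/V -> PSh(M)/U.  An object of PSh(M)/U is a map
   f : X -> U, with inverse image the projection from X *_U V to V. *)
Definition pure (M : monoidType) (n : int) (V U : rset M) (i : rhom V U) :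
    Prop :=
  forall (X : rset M) (f : rhom X U),
    (n = -1 -> forall A : Type,
       inj_mod (@H0_eq M A X) (@H0_eq M A (pullback f i))
         (H0_pull (pb_fst f i))) /\
    (forall m : nat, m%:Z <= n -> H_bij m (pb_fst f i)).

(* The subtopos of sheaves for the topology whose dense monomorphisms are the
   (n-1)-pure ones. *)
Definition topos_le (M : monoidType) (n : int) : rset M -> Prop :=
  is_sheaf (@pure M (n - 1)).

(* The union of subtoposes is their supremum: the smallest subtopos containing
   all of them (an intersection of subtoposes is again a subtopos). *)
Definition topos_lt_infty (M : monoidType) (F : rset M) : Prop :=
  forall P : rset M -> Prop, is_subtopos P ->
    (forall n : int, -1 <= n -> forall G, topos_le n G -> P G) -> P F.

Definition le_is_union (M : monoidType) (n : int) : Prop :=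
  forall F : rset M, topos_le n F <-> topos_lt_infty F.

Definition n_dimensional (M : monoidType) (n : int) : Prop :=
  [/\ -1 <= n, le_is_union M n &
      forall k : int, -1 <= k -> le_is_union M k -> n <= k].

Definition without_boundary (M : monoidType) : Prop :=
  forall F : rset M, topos_lt_infty F.

(* Main.v *)
Require Import Defs.
From mathcomp Require Import all_boot all_order all_algebra.
From HB Require Import structures.
From mathcomp Require Import boolp classical_sets.
Import Defs.
Set Implicit Arguments.
Unset Strict Implicit.
Unset Printing Implicit Defensive.
Local Open Scope ring_scope.

(** Everything rests on one invariant of a nonempty word: its first letter,
which right multiplication does not change.  Coarsened to the question whether
the first letter is a chosen generator [a], it is a morphism from [M] to a
three-element monoid.

No subtopos is lost at level 1, because a 0-pure monomorphism [V >-> U] is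
invertible ([pure0_surj]).  Were [u] outside [V], the words [m] with
[u m] in [V] would all be nonempty, so the test on the first letter would be a
section of a constant object over this right ideal of [M].  By 0-purity it
extends to the connected object [M], hence is constant.  But 0-purity also
forbids the ideals of the words [n] with [u a n], resp. [u b n], in [V] to be
empty, so the ideal has words that start with [a] and words that start with
[b].  Hence every object is a sheaf for the 0-pure monomorphisms, and the union
of the subtoposes is the whole topos.

At every level below 1 something is lost, because the inclusion into [M] of
the nonempty words is (-1)-pure: over any object, a section of a constant
object is determined at [x] by its value at [x a] ([nonempty_pure]); at level -1 every
monomorphism is dense, this one included.  The test
on the first letter does not extend along this inclusion, so a constant object
with two elements is not a sheaf ([constant_not_sheaf]). *)

(** * Words of a free monoid and their first letters *)

(** [Some true] stands for the words that start with a chosen generator, [Some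
false] for the other nonempty words, and [None] for the empty word. *)
Definition head_monoid : Type := option bool.

HB.instance Definition _ := Choice.on head_monoid.

Definition head_mul (x y : head_monoid) : head_monoid :=
  if x is Some _ then x else y.

Lemma head_mulA : associative head_mul. Proof. by case. Qed.
Lemma head_mul1 : left_id None head_mul. Proof. by []. Qed.
Lemma head_1mul : right_id None head_mul. Proof. by case. Qed.

HB.instance Definition _ :=
  isMonoid.Build head_monoid head_mulA head_mul1 head_1mul.

(** The instances are attached to a name that mentions the closure proofs: for
the bare sigma type those could not be inferred. *)
Definition submonoid (M : monoidType) (P : M -> Prop)
    (_ : P 1%g) (_ : forall x y, P x -> P y -> P (x * y)%g) : Type :=
  {x : M | `[< P x >]}.

Section Submonoid.
Variables (M : monoidType) (P : M -> Prop).
Hypotheses (P1 : P 1%g) (PM : forall x y, P x -> P y -> P (x * y)%g).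

HB.instance Definition _ := SubChoice.on (submonoid P1 PM).

Lemma submonoid_closed : monoid_closed (fun x : M => `[< P x >]).
Proof.
split=> [|x y]; rewrite !unfold_in; first exact/asboolP.
by move=> /asboolP Px /asboolP Py; apply/asboolP; exact: PM.
Qed.

HB.instance Definition _ :=
  SubChoice_isSubMonoid.Build M _ (submonoid P1 PM) submonoid_closed.

End Submonoid.

(** Induction on words, drawn from the uniqueness half of the universal
property: a map from [M] to the submonoid [P] that fixes the generators becomes
the identity of [M] when followed by the inclusion. *)
Lemma free_on_ind (S : Type) (M : monoidType) (i : S -> M) (P : M -> Prop) :
  free_on i -> P 1%g -> (forall x y, P x -> P y -> P (x * y)%g) ->
  (forall s, P (i s)) -> forall x, P x.
Proof.
move=> free_i P1 PM Pi x.
pose sub := submonoid P1 PM.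
have [[r ri] _] :=
  free_i sub (fun s => exist _ (i s) (introT (asboolP _) (Pi s))).
have [_ uniq_i] := free_i M i.
have e : (\val : sub -> M) (r x) = x.
  apply: (uniq_i ((val : sub -> M) \o r : UMagmaMorphism.type _ _) idfun) => // s.
  by rewrite /= ri.
by rewrite -e; apply/asboolP/(valP (r x)).
Qed.

Lemma headM (M : monoidType) (h : UMagmaMorphism.type M head_monoid) m n :
  h (m * n)%g = head_mul (h m) (h n).
Proof. exact: gmulfM. Qed.

(** The existence half of the universal property provides [h], which tells two
letters apart; induction on words shows that [h] detects the empty word. *)
Lemma free_on_head (S : Type) (M : monoidType) (i : S -> M) (a b : S) :
  free_on i -> a <> b ->
  exists h : UMagmaMorphism.type M head_monoid,
    [/\ h (i a) = Some true, h (i b) = Some false &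
        forall m, h m = None -> m = 1%g].
Proof.
move=> free_i ab.
have [[h hi] _] := free_i head_monoid (fun s => Some `[< s = a >]).
exists h; split=> [||m]; rewrite ?hi.
- by congr Some; apply/asboolP.
- by congr Some; apply/asboolP => ba; exact/ab/esym.
move: m; apply: (free_on_ind (P := fun m => h m = None -> m = 1%g) free_i).
- by [].
- move=> x y IHx IHy.
  rewrite headM => hxy; have hx : h x = None by case: (h x) hxy.
  by rewrite (IHx hx) (IHy _) ?mulg1 // -hxy hx.
- by move=> s; rewrite hi.
Qed.

Lemma head_mulr (M : monoidType) (h : UMagmaMorphism.type M head_monoid) m n :
  h m <> None -> h (m * n)%g = h m.
Proof. by rewrite headM; case: (h m). Qed.

(** * Monomorphisms of right M-sets *)

Definition regular (M : monoidType) : rset M :=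
  @RSet M M (fun x m => x * m)%g (@mulg1 M) (@mulgA M).

Definition orbit_map (M : monoidType) (U : rset M) (u : U) :
    rhom (regular M) U :=
  @RHom M (regular M) U (ract u) (@ractM M U u).

Definition const_map (M : monoidType) (X : rset M) (A : Type) (a : A) :
    rhom X (constant M A) :=
  @RHom M X (constant M A) (fun _ => a) (fun _ _ => erefl).

Lemma regular_section (M : monoidType) (A : Type)
    (t : rhom (regular M) (constant M A)) m : t m = t 1%g.
Proof. by rewrite -[in LHS](mul1g m); exact: (rfunJ t 1%g m). Qed.

Lemma iso_extends (M : monoidType) (V U F : rset M) (i : rhom V U) :
  injective i -> (forall u, exists v, i v = u) ->
  forall f : rhom V F,
    (exists g : rhom U F, forall v, g (i v) = f v) /\
    (forall g h : rhom U F, (forall v, g (i v) = f v) ->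
       (forall v, h (i v) = f v) -> forall u, g u = h u).
Proof.
move=> inj_i surj_i f; split; last first.
  by move=> g h gE hE u; have [v <-] := surj_i u; rewrite gE hE.
have [j jE] := choice surj_i.
have fjJ u m : f (j (ract u m)) = ract (f (j u)) m.
  by rewrite -rfunJ; congr (f _); apply: inj_i; rewrite rfunJ !jE.
by exists (RHom fjJ) => v /=; congr (f _); apply: inj_i; rewrite jE.
Qed.

(** Two distinct constant sections over [regular M] have to differ somewhere on
the pullback along the orbit map of [u], which is therefore inhabited. *)
Lemma pure0_meets (M : monoidType) (V U : rset M) (i : rhom V U) (u : U) :
  pure 0 i -> exists n v, i v = ract u n.
Proof.
move=> pure_i; have [_ /(_ 0%N isT bool) [inj_s _]] := pure_i _ (orbit_map u).
apply: contrapT => empty.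
suff /inj_s /(_ 1%g) : H0_eq
    (H0_pull (pb_fst (orbit_map u) i) (const_map (regular M) true))
    (H0_pull (pb_fst (orbit_map u) i) (const_map (regular M) false)) by [].
by case=> -[n v] /= nv; case: empty; exists n, v; rewrite -nv.
Qed.

(** The words [m] with [u m] in [V] are all nonempty if [u] is outside the
image of [V];
then the test on the first letter is a section over the ideal they form, and
extends to [regular M] although it takes both values. *)
Lemma pure0_surj (S : Type) (M : monoidType) (i : S -> M) (a b : S)
    (V U : rset M) (j : rhom V U) :
  free_on i -> a <> b -> pure 0 j -> forall u, exists v, j v = u.
Proof.
move=> free_i ab pure_j u; apply: contrapT => notVu.
have [h [ha hb h1]] := free_on_head free_i ab.
pose p := orbit_map u; pose I := pullback p j.
have nonempty (z : I) : h (sval z).1 <> None.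
  case: z => -[m v] /= e /h1 m1; apply: notVu; exists v.
  by rewrite -e m1 ract1.
have headJ (z : I) m :
    (h (sval (ract z m)).1 == Some true) = (h (sval z).1 == Some true).
  by rewrite /= head_mulr //; exact: nonempty.
pose s : H0 bool I := @RHom M I (constant M bool) _ headJ.
have [_ /(_ 0%N isT bool) [_ /(_ s) [t tE]]] := pure_j _ p.
have head_t (c : M) : h c <> None -> (h c == Some true) = t 1%g.
  move=> hc.
  have [n [v e]] := pure0_meets (ract u c) pure_j.
  have e' : p (c * n)%g = j v by rewrite /= ractM e.
  have := tE (exist _ ((c * n)%g, v) e').
  by rewrite /H0_pull /= regular_section => ->; rewrite head_mulr.
have ta : true = t 1%g by rewrite -(head_t (i a)) ha.
have tb : false = t 1%g by rewrite -(head_t (i b)) hb.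
by rewrite -tb in ta.
Qed.

Section NonemptyWords.
Variables (M : monoidType) (h : UMagmaMorphism.type M head_monoid).

Definition nonempty_car : Type := {m : M | h m <> None}.

Lemma nonempty_act_subproof (x : nonempty_car) m : h (sval x * m)%g <> None.
Proof. by rewrite head_mulr; exact: (proj2_sig x). Qed.

Definition nonempty_act (x : nonempty_car) (m : M) : nonempty_car :=
  exist (fun m => h m <> None) _ (@nonempty_act_subproof x m).

Lemma nonempty_act1 x : nonempty_act x 1%g = x.
Proof. by case: x => x hx; apply: eq_exist; rewrite /= mulg1. Qed.

Lemma nonempty_actM x m n :
  nonempty_act x (m * n)%g = nonempty_act (nonempty_act x m) n.
Proof. by apply: eq_exist; rewrite /= mulgA. Qed.

Definition nonempty_words : rset M := RSet nonempty_act1 nonempty_actM.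

Definition nonempty_incl : rhom nonempty_words (regular M) :=
  @RHom M nonempty_words (regular M) sval (fun _ _ => erefl).

Lemma nonempty_incl_inj : injective nonempty_incl.
Proof. by case=> x hx [y hy] /= xy; exact: eq_exist. Qed.

(** A section is determined at [x] by its value at [x a], and [x a] lies over
a nonempty word. *)
Lemma nonempty_pure (a : M) (n : int) :
  h a <> None -> n < 0 -> pure n nonempty_incl.
Proof.
move=> ha n0 X f; split=> [_ A s t st x|m mn]; last first.
  by have := Order.POrderTheory.le_lt_trans mn n0.
have hxa : h (f (ract x a)) <> None.
  by rewrite rfunJ /= headM; case: (h (f x)).
have := st (exist _ (ract x a, exist _ (f (ract x a)) hxa) erefl).
by rewrite /H0_pull /= !rfunJ.
Qed.

(** The test on the first letter is a map to the constant object that takes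
both values, so no map from the connected object [regular M] extends it. *)
Lemma constant_not_sheaf (D : mono_class M) (a b : M) :
  D _ _ nonempty_incl -> h a = Some true -> h b = Some false ->
  ~ is_sheaf D (constant M bool).
Proof.
move=> Di ha hb sheaf.
have headJ (x : nonempty_words) m :
    (h (sval (ract x m)) == Some true) = (h (sval x) == Some true).
  by rewrite /= head_mulr //; exact: (proj2_sig x).
pose s : rhom nonempty_words (constant M bool) :=
  @RHom M nonempty_words (constant M bool) _ headJ.
have [[t tE] _] := sheaf _ _ _ nonempty_incl_inj Di s.
have na : h a <> None by rewrite ha.
have nb : h b <> None by rewrite hb.
have ta := tE (exist _ a na); have tb := tE (exist _ b nb).
by rewrite /= regular_section ha in ta; rewrite /= regular_section hb ta in tb.
Qed.

End NonemptyWords.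

(** * The dimension *)

Theorem proposition8p16 (S : Type) (M : monoidType) (i : S -> M)
    (hfree : free_on i) (hgen : exists a b : S, a <> b) :
  n_dimensional M 1 /\ without_boundary M.
Proof.
have [a [b ab]] := hgen.
have [h [ha hb _]] := free_on_head hfree ab.
have le1 (F : rset M) : topos_le 1 F.
  move=> V U j inj_j pure_j; apply: iso_extends => //.
  exact: pure0_surj hfree ab pure_j.
have whole : without_boundary M.
  by move=> F P _ subP; exact: (subP 1 isT F (le1 F)).
split; [split=> [|F|k _ union_k]|exact: whole].
- by [].
- by split=> _; [exact: whole|exact: le1].
rewrite Order.TotalTheory.leNgt; apply/negP => k1.
have /union_k sheaf := whole (constant M bool).
apply: (constant_not_sheaf _ ha hb) sheaf.
by apply: (@nonempty_pure _ _ (i a)); rewrite ?ha // Num.Theory.subr_lt0.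
Qed.
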